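(* Every caterpillar graph $E$ satisfies $$p(E)=\left\lceil \frac{d+1}{2}\right\rceil,$$ where $d$ is the diameter of $E$ and $p(E)$ is the optimal-pegging number of $E$.
   Context: A distribution $D$ of pegs on a graph $G$ is a subset of $V(G)$ (the vertices holding one peg each). A pegging move from $D$ to $D'$: there are distinct vertices $u,v\in D$ and $w\notin D$ with both $u$ and $w$ adjacent to $v$, and $D'=(D\setminus\{u,v\})\cup\{w\}$. A vertex $x$ is reachable from $D$ if some finite (possibly empty) sequence of pegging moves starting at $D$ yields a distribution containing $x$. The reach $R(D)$ is the set of vertices reachable from $D$; $G$ can be pegged by $D$ if $R(D)=V(G)$. The optimal-pegging number $p(G)$ is the minimum size of a distribution on $G$ that can peg $G$. A caterpillar graph is a tree such that if all leaves (vertices of degree $1$) and their incident edges are removed, the remainder of the graph forms a (finite) path. Here a path has at least one vertex, a single vertex being allowed; in particular the tree with exactly two vertices is not a caterpillar. *)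

(* Defs.v *)
From mathcomp Require Import all_boot.

Set Implicit Arguments.
Unset Strict Implicit.
Unset Printing Implicit Defensive.

(* A finite simple graph on a finType T is an adjacency relation e : rel T
   that is symmetric and irreflexive; both are hypotheses of the theorem. *)

Section Graph.

Variables (T : finType) (e : rel T).

Definition degree (x : T) : nat := #|[set y | e x y]|.

Definition connected_graph : Prop := 0 < #|T| /\ forall x y : T, connect e x y.

(* The bound 2 < size c excludes the degenerate closed walks x, y, x. *)
Definition acyclic : Prop := forall c : seq T, 2 < size c -> ~~ ucycleb e c.

Definition is_tree : Prop := connected_graph /\ acyclic.

(* The subgraph induced on A is isomorphic to the path with n + 1 vertices;
   n = 0 gives the single-vertex path. *)
Definition induces_path (A : {set T}) : Prop :=
  exists (n : nat) (f : 'I_n.+1 -> T),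
    [/\ injective f,
        [set f i | i : 'I_n.+1] = A
      & forall i j : 'I_n.+1, e (f i) (f j) = (i.+1 == j) || (j.+1 == i)].

Definition leaves : {set T} := [set x | degree x == 1].

(* Removing the leaves deletes them together with their incident edges. *)
Definition is_caterpillar : Prop := is_tree /\ induces_path (~: leaves).

Definition has_walk (n : nat) (x y : T) : bool :=
  [exists p : n.-tuple T, path e x p && (last x p == y)].

(* In a finite graph a shortest walk has fewer than #|T| edges; dist x y is
   the junk value #|T| when x and y are not connected. *)
Definition dist (x y : T) : nat :=
  find (fun n => has_walk n x y) (iota 0 #|T|).

Definition diameter : nat := \max_(x : T) \max_(y : T) dist x y.

Definition peg_move (D D' : {set T}) : bool :=
  [exists u, exists v, exists w,
    [&& u \in D, v \in D, u != v, w \notin D, e u v, e w v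
      & D' == (D :\: [set u; v]) :|: [set w]]].

Definition reach (D : {set T}) : {set T} :=
  [set x | [exists D' : {set T}, connect peg_move D D' && (x \in D')]].

Definition can_peg (D : {set T}) : bool := reach D == setT.

(* setT satisfies can_peg (lemma can_peg_setT), so this is a true minimum. *)
Definition optimal_pegging : nat :=
  #|[arg min_(D < setT | can_peg D) #|D|]|.

Lemma can_peg_setT : can_peg setT.
Proof.
apply/eqP/setP=> x; rewrite !inE; apply/existsP; exists setT.
by rewrite connect0 inE.
Qed.

Lemma optimal_pegging_attained :
  exists2 D : {set T}, can_peg D & #|D| = optimal_pegging.
Proof.
rewrite /optimal_pegging; case: arg_minnP; first exact: can_peg_setT.
by move=> D pD _; exists D.
Qed.

Lemma optimal_pegging_min (D : {set T}) : can_peg D -> optimal_pegging <= #|D|.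
Proof.
rewrite /optimal_pegging; case: arg_minnP; first exact: can_peg_setT.
by move=> D0 _; apply.
Qed.

Lemma dist_walk (x y : T) : connect e x y -> has_walk (dist x y) x y.
Proof.
case/connectP=> p /shortenP[q eq_q uq _] ->.
set P := fun n => has_walk n x (last x q).
have szq : size q < #|T|.
  by rewrite -[(size q).+1]/(size (x :: q)) -(card_uniqP uq) max_card.
have hP : has P (iota 0 #|T|).
  apply/hasP; exists (size q); first by rewrite mem_iota.
  by apply/existsP; exists (in_tuple q); rewrite eq_q eqxx.
have := nth_find 0 hP; rewrite nth_iota //.
by move: hP; rewrite has_find size_iota.
Qed.

Lemma dist_min (x y : T) (p : seq T) :
  path e x p -> last x p = y -> dist x y <= size p.
Proof.
move=> ep <-; rewrite leqNgt; apply/negP=> lt_p.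
have szT : size p < #|T|.
  apply: leq_trans lt_p _.
  have := find_size (fun n => has_walk n x (last x p)) (iota 0 #|T|).
  by rewrite size_iota.
have := before_find 0 lt_p; rewrite nth_iota // add0n /=.
suff -> : has_walk (size p) x (last x p) by [].
apply/existsP.
by exists (in_tuple p); rewrite ep eqxx.
Qed.

End Graph.

(* Main.v *)
Require Import Defs.
From mathcomp Require Import all_boot all_order all_algebra.
From mathcomp Require Import realalg.
From mathcomp Require Import zify ring lra.

Set Implicit Arguments.
Unset Strict Implicit.
Unset Printing Implicit Defensive.

Import Order.TTheory GRing.Theory Num.Theory.

(** The upper bound is a construction. If a path with 2k vertices dominates the
graph, put pegs on its first vertex w_0 and on every second vertex from w_1 on:
w_0, w_1, w_3, w_5, and so on, k + 1 pegs in all. The two adjacent pegs on w_0,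
w_1 reach every neighbor of either, and one move turns them into a pair on w_2,
w_3, so the pair walks along the whole path and reaches everything next to it
([optimal_pegging_dominating_path]). In a caterpillar the spine dominates; when
it has an odd number of vertices, a leaf is added in front
([optimal_pegging_spine]). Unless the caterpillar is a single vertex, a spine
with n + 1 vertices forces diameter at least n + 2, because there are two
leaves, one at each tip ([diameter_ge_spine]).

The lower bound holds in every connected graph ([can_peg_diameter]): k pegs that
reach everything force d + 1 <= 2k. Sort the vertices into levels by their
distance from an endpoint x of a diameter, so that the levels 0, ..., d are all
inhabited; let c_t be the number of pegs on level t. Fix a level t without pegs
and give a vertex at j levels from t the weight phi^-j, phi being the golden
ratio. As phi^-2 + phi^-1 = 1, as long as level t is empty no move increases the
weight of the pegs on either side of t, and the first move that enters level t
uses two pegs of total weight at least 1, both on the same side. So if level t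
is to be reached, the pegs below it weigh at least 1 or the pegs above it do
([blocked_reach], [can_peg_levels]).

It remains to count ([covered_count]). Let A_t be the weight at level t of the
pegs on levels < t; then phi A_(t+1) = A_t + c_t, and the symmetric quantity B
satisfies the same recurrence from the other end. Measure A by f(A), the number
of consecutive empty levels that the weight A can cross: the least m with A <
phi^m. Crossing an empty level with A >= 1 lowers f by exactly 1, and c > 0 pegs
on one level raise f by at most c - 1, plus 1 more if A is on the brink, 1/phi
<= A < 1 ([goldlog_pegs]). Summed over both directions, a level with c > 0 pegs
therefore pays for 2c - 1 empty levels, with one exception: if both A and B are
on the brink it seems to pay for one too many. But then B > 0, so there is a
next level, and that level has a surplus: either it is empty and covered from
both sides, or it carries a single peg and raises neither f. Carrying this debt
of 1 across gives the local inequality [goldlog_step]; adding it up over all the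
levels gives d + 1 <= 2k. *)

(** * The golden ratio and the counting of covered levels *)

Section GoldenWeights.

Local Open Scope ring_scope.

Variables (R : realFieldType) (phi : R).
Hypotheses (phi_gt0 : 0 < phi) (phi_sqr : phi ^+ 2 = phi + 1).

Lemma phi_bounds : 8/5 < phi < 5/3.
Proof using phi_gt0 phi_sqr.
by move: phi_gt0 phi_sqr; rewrite expr2 => ? ?; apply/andP; split; nra.
Qed.

Lemma phi_cube : phi ^+ 3 = phi *+ 2 + 1.
Proof using phi_sqr.
by rewrite exprS phi_sqr mulrDr -expr2 phi_sqr; ring.
Qed.

Lemma natS_le_phiX c : (2 < c)%N -> (c.+1)%:R <= phi ^+ c.
Proof using phi_gt0 phi_sqr.
have /andP[lo _] := phi_bounds.
elim: c => // c IHc; rewrite leq_eqVlt => /predU1P[[<-]|c2].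
  by rewrite phi_cube; lra.
have {}IHc := IHc c2; rewrite exprS -natr1.
have : 2 <= c.+1%:R :> R by rewrite ler_nat; lia.
by nra.
Qed.

Lemma nat_lt_phiX c : c%:R < phi ^+ c.
Proof using phi_gt0 phi_sqr.
have /andP[lo _] := phi_bounds.
case: c => [|[|[|c]]]; rewrite ?expr0 ?expr1 ?phi_sqr //; [lra | lra |].
by apply: lt_le_trans (natS_le_phiX _) => //; rewrite ltr_nat.
Qed.

(** For r < phi^M this is the least m with r < phi^m, that is
1 + floor(log_phi r) when r >= 1 and 0 when r < 1. It is written as a sum of
truth values over m < M because dividing r by phi then shifts the terms. *)
Definition goldlog (M : nat) (r : R) : nat := (\sum_(m < M) (phi ^+ m <= r)%R)%N.

(** The weights r < 1 that one extra peg lifts to at least 1, as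
(r + 1) / phi >= 1 exactly when phi * r >= 1. *)
Definition brink (r : R) : bool := (1 <= phi * r) && (r < 1).

Lemma goldlog0 M : goldlog M 0 = 0%N.
Proof using phi_gt0.
by rewrite /goldlog big1 // => m _; rewrite leNgt exprn_gt0.
Qed.

Lemma goldlog_homo M r s : r <= s -> (goldlog M r <= goldlog M s)%N.
Proof.
move=> rs; apply: leq_sum => m _.
by case: (boolP (_ <= r)) => // /le_trans/(_ rs) ->.
Qed.

Lemma goldlog_le M j r : r < phi ^+ j -> (goldlog M r <= j)%N.
Proof using phi_gt0 phi_sqr.
have /andP[lo _] := phi_bounds.
move=> ltj; rewrite /goldlog.
apply: (@leq_trans (\sum_(m < M) (m < j))%N).
  apply: leq_sum => m _; case: (ltnP m j) => [_|jm]; first exact: leq_b1.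
  rewrite leqn0 eqb0 -ltNge; apply: lt_le_trans ltj _.
  by apply: ler_weXn2l => //; lra.
elim: M j {ltj} => [|M IHM] [|j]; rewrite ?big_ord0 //.
  by rewrite big1.
by rewrite big_ord_recl /= add1n ltnS; apply: IHM.
Qed.

Lemma goldlog_gt0 M r : (0 < M)%N -> 1 <= r -> (0 < goldlog M r)%N.
Proof. by case: M => // M _ r1; rewrite /goldlog big_ord_recl expr0 r1. Qed.

Lemma goldlog_mul M r : (goldlog M (phi * r) <= (goldlog M r).+1)%N.
Proof using phi_gt0.
case: M => [|M]; first by rewrite /goldlog !big_ord0.
rewrite [goldlog _ (_ * _)]big_ord_recl -(add1n (goldlog _ _)) leq_add ?leq_b1 //.
rewrite [goldlog _ r]big_ord_recr /=.
apply: leq_trans (leq_addr _ _); apply: leq_sum => m _.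
by rewrite exprS ler_pM2l.
Qed.

Lemma goldlog_mulX M j r s : s <= phi ^+ j * r -> (goldlog M s <= goldlog M r + j)%N.
Proof using phi_gt0.
move/(goldlog_homo M)/leq_trans; apply.
elim: j => [|j IHj]; first by rewrite expr0 mul1r addn0.
by rewrite exprS -mulrA (leq_trans (goldlog_mul _ _)) // addnS.
Qed.

(** The term m of the sum for a' is the term m + 1 of the sum for a, so the two
sums differ by the term m = 0 of the latter; the assumption on a kills the term
m = M that would come in at the other end. *)
Lemma goldlog_empty M a a' : a < phi ^+ M -> phi * a' = a ->
  goldlog M a = ((1 <= a)%R + goldlog M a')%N.
Proof using phi_gt0.
case: M => [|M] aM a'E.
  by rewrite /goldlog !big_ord0 leNgt -[1](expr0 phi) aM.
rewrite {1}/goldlog big_ord_recl expr0; congr (_ + _)%N.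
rewrite /goldlog big_ord_recr /= [(_ <= a')%R]leNgt.
rewrite -(ltr_pM2l phi_gt0) a'E -exprS aM addn0.
by apply: eq_bigr => m _; rewrite -a'E exprS ler_pM2l.
Qed.

(** For c > 2 the bound follows from c + 1 <= phi^c. For c = 1 and c = 2 the
weight after the level is a' <= a, respectively a' <= phi * a, once a is large;
for small a the values phi + 1, 2 phi + 1 of phi^2, phi^3 decide. *)
Lemma goldlog_pegs M c a a' : (0 < M)%N -> (0 < c)%N -> 0 <= a ->
  phi * a' = a + c%:R -> (goldlog M a' <= goldlog M a + c.-1 + brink a)%N.
Proof using phi_gt0 phi_sqr.
have /andP[lo hi] := phi_bounds.
have phi2 := phi_sqr; rewrite expr2 in phi2.
have phi3 := phi_cube.
move=> M0 c0 a0 a'E.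
case: (ltnP 2 c) => [c2|].
  apply: leq_trans (leq_addr _ _).
  have cX := natS_le_phiX c2; rewrite -natr1 in cX.
  have XE : phi * phi ^+ c.-1 = phi ^+ c by rewrite -exprS prednK.
  have n0 : 0 <= c%:R :> R by [].
  case: (ltP a 1) => a1.
    apply: leq_trans (leq_addl _ _); apply: goldlog_le.
    by rewrite -(ltr_pM2l phi_gt0) XE a'E; lra.
  apply: goldlog_mulX; rewrite -(ler_pM2l phi_gt0) mulrA XE a'E.
  by nra.
case: c c0 a'E => [|[|[|c]]] //= _ a'E _; rewrite ?addn0 /brink.
  case: (ltP a 1) => a1; last first.
    rewrite andbF addn0; case: (ltP a phi) => aphi.
      apply: leq_trans (goldlog_gt0 M0 a1); apply: goldlog_le.
      by rewrite expr1; nra.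
    by rewrite -[goldlog M a]addn0; apply: goldlog_mulX; rewrite expr0; nra.
  rewrite andbT; apply: leq_trans (leq_addl _ _).
  case: (lerP 1 (phi * a)) => za; apply: goldlog_le; rewrite ?expr0 ?expr1; nra.
case: (ltP a 1) => a1; last first.
  rewrite andbF addn0; case: (ltP (phi * a) 2) => aphi.
    rewrite addn1; apply: (@leq_trans 2%N); last by rewrite ltnS goldlog_gt0.
    by apply: goldlog_le; rewrite phi_sqr; nra.
  by apply: goldlog_mulX; rewrite expr1; nra.
rewrite andbT -addnA; apply: leq_trans (leq_addl _ _).
by case: (lerP 1 (phi * a)) => za; apply: goldlog_le; rewrite ?phi_sqr ?expr1; nra.
Qed.

(** Here a is the weight arriving at a cut from below, b the weight arriving
from above on the level just below the cut. If that level carries pegs and was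
on the brink in both directions, then a >= 1 and b is still what it was, on the
brink: [debt a b] remembers that the cut owes one unit. *)
Definition debt (a b : R) : bool := (1 <= a) && brink b.

(** The budget of a single level with c pegs: [a], [b] arrive at it from below
and from above, [a'], [b'] leave it upwards and downwards. A debt [debt a b']
that comes in from below is always settled here: if c = 0 then b = phi b' >= 1,
so the level is covered from both sides; if c > 0 then phi b' < phi < 2 leaves
room for one peg only and b below the brink, while a >= 1 is past it. A new debt
is made when a and b are both on the brink, and then a' >= 1. *)
Lemma goldlog_step M c a b a' b' : (0 < M)%N ->
  0 <= a < phi ^+ M -> 0 <= b < phi ^+ M ->
  phi * a' = a + c%:R -> phi * b' = b + c%:R ->
  (c = 0%N -> 1 <= a \/ 1 <= b) ->
  (goldlog M a' + goldlog M b' + debt a b' + 1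
     <= goldlog M a + goldlog M b + debt a' b + c.*2)%N.
Proof using phi_gt0 phi_sqr.
have /andP[lo hi] := phi_bounds.
have phi2 := phi_sqr; rewrite expr2 in phi2.
move=> M0 /andP[a0 aM] /andP[b0 bM] a'E b'E cov.
case: (posnP c) => [c0|c_gt0].
  rewrite c0 !addr0 in a'E b'E.
  rewrite (goldlog_empty aM a'E) (goldlog_empty bM b'E) /debt /brink b'E.
  have covb : (1 <= a) || (1 <= b) by apply/orP; exact: cov.
  move: (goldlog M a') (goldlog M b') (b' < 1) covb => ra rb z {cov}.
  by case: (1 <= a) => /=; case: (1 <= b) => //= _; case: z; rewrite /=; clear; lia.
have ra := goldlog_pegs M0 c_gt0 a0 a'E; have rb := goldlog_pegs M0 c_gt0 b0 b'E.
suff: (brink a + brink b + debt a b' <= debt a' b + 1)%N.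
  by move: ra rb c_gt0; clear; move: (goldlog M a) (goldlog M a') => x x'; lia.
rewrite /debt; case: (boolP (1 <= a)) => [a1|_] /=.
  rewrite /brink [a < 1]ltNge a1 andbF /=.
  have [/andP[_ b'1]|_] := boolP (_ && (b' < 1)).
    have c1 : c = 1%N.
      case: c c_gt0 a'E b'E {cov ra rb} => [|[|c]] // _ _ b'E; exfalso.
      have : 2 <= c.+2%:R :> R by rewrite ler_nat.
      by nra.
    suff -> : (1 <= phi * b) = false by rewrite addn1.
    by apply/negbTE; rewrite -ltNge; rewrite c1 in b'E; nra.
  by rewrite addn0 add0n (leq_trans (leq_b1 _)) ?leq_addl.
rewrite addn0; case: (boolP (brink b)) => /= [_|_]; last first.
  by rewrite addn0 (leq_trans (leq_b1 _)) ?leq_addl.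
rewrite andbT; case: (boolP (brink a)) => [/andP[za _]|_]; last first.
  by rewrite add0n leq_addl.
suff -> : 1 <= a' by [].
have : 1 <= c%:R :> R by rewrite ler1n.
by nra.
Qed.

(** The sum over i < t of c_i phi^-(t-i), see [inflow_pegs_at]. *)
Fixpoint inflow (c : nat -> nat) (t : nat) : R :=
  if t is t'.+1 then phi^-1 * (inflow c t' + (c t')%:R) else 0.

Lemma inflow_bounds c t : 0 <= inflow c t <= (\sum_(i < t) c i)%:R.
Proof using phi_gt0 phi_sqr.
have /andP[lo hi] := phi_bounds.
elim: t => [|t /andP[IH0 IH1]]; first by rewrite big_ord0 lexx.
have i0 : 0 <= inflow c t + (c t)%:R by apply: addr_ge0.
rewrite big_ord_recr natrD /= mulr_ge0 // ?invr_ge0 ?(ltW phi_gt0) //=.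
rewrite ler_pdivrMl //.
have : 0 <= (\sum_(i < t) c i)%:R + (c t)%:R - (inflow c t + (c t)%:R).
  by lra.
by nra.
Qed.

Lemma phi_inflowS c t : phi * inflow c t.+1 = inflow c t + (c t)%:R.
Proof using phi_gt0. by rewrite /= mulrA divff ?mul1r ?gt_eqF. Qed.

(** The weight from above is the weight from below of the reversed sequence.
The local inequality [goldlog_step] telescopes; nothing is owed at either end,
where the incoming weight is 0. *)
Lemma covered_count (c : nat -> nat) n :
  (forall t, (t < n)%N -> c t = 0%N ->
     1 <= inflow c t \/ 1 <= inflow (fun i => c (n.-1 - i)%N) (n.-1 - t)%N) ->
  (n <= (\sum_(i < n) c i).*2)%N.
Proof using phi_gt0 phi_sqr.
move=> cov; set c' := (fun i => _) in cov.
set K := (\sum_(i < n) c i)%N.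
have K' : (\sum_(i < n) c' i)%N = K.
  rewrite /K (reindex_inj rev_ord_inj); apply: eq_bigr => i _ /=.
  by rewrite /c'; congr c; have := ltn_ord i; lia.
(* The exponent K + 1 is chosen so that phi^(K+1) exceeds all the weights. *)
have bound (d : nat -> nat) : (\sum_(i < n) d i)%N = K -> forall t, (t <= n)%N ->
    0 <= inflow d t < phi ^+ K.+1.
  move=> dK t tn; have /andP[-> le] := inflow_bounds d t.
  apply: le_lt_trans le (lt_trans _ (nat_lt_phiX _)).
  rewrite ltr_nat ltnS -dK -!(big_mkord xpredT d).
  by rewrite [leqRHS](big_cat_nat (n := t)) //= leq_addr.
pose f := goldlog K.+1; pose A := inflow c; pose B t := inflow c' (n - t)%N.
(* B t is the weight on level t - 1 of the pegs on the levels t, ..., n - 1. *)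
have inv t : (t <= n)%N ->
  (f (A t) + f (B 0) + t
     <= f (B t) + debt (A t) (B t) + (\sum_(i < t) c i).*2)%N.
  elim: t => [|t IHt] tn; first by rewrite big_ord0 /f goldlog0; lia.
  rewrite big_ord_recr doubleD.
  have BE : phi * B t = B t.+1 + (c t)%:R.
    rewrite /B (_ : n - t = (n - t.+1).+1)%N ?phi_inflowS; last by lia.
    by rewrite /c'; congr (_ + (c _)%:R); lia.
  have := @goldlog_step K.+1 (c t) (A t) (B t.+1) (A t.+1) (B t) isT.
  rewrite BE phi_inflowS !bound //; try lia.
  have covt : c t = 0%N -> 1 <= A t \/ 1 <= B t.+1.
    move/(cov t tn); rewrite (_ : n.-1 - t = n - t.+1)%N //; lia.
  move=> /(_ isT isT erefl erefl covt).
  have := IHt (ltnW tn); rewrite -/f /=; lia.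
have := inv n (leqnn n).
rewrite {2 3}/B subnn /= /f goldlog0 /debt /brink mulr0 ler10 /= andbF.
by rewrite -/K; lia.
Qed.

End GoldenWeights.

(** * Empty levels that cannot be entered *)

Section LowerBound.

Local Open Scope ring_scope.

Variables (R : realFieldType) (phi : R).
Hypotheses (phi_gt0 : 0 < phi) (phi_sqr : phi ^+ 2 = phi + 1).
Variables (T : finType) (e : rel T).

Lemma psiX_le i j : (i <= j)%N -> phi^-1 ^+ j <= phi^-1 ^+ i.
Proof using phi_gt0 phi_sqr.
have /andP[lo _] := phi_bounds phi_gt0 phi_sqr.
move=> ij; apply: ler_wiXn2l => //; first by rewrite invr_ge0 ltW.
by rewrite invf_le1 //; lra.
Qed.

(** The weight phi^-i is what phi^-(i+1) and phi^-(i+2) add up to. *)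
Lemma psiX_move i j k : (j <= i.+1)%N -> (k <= i.+2)%N ->
  phi^-1 ^+ i <= phi^-1 ^+ k + phi^-1 ^+ j.
Proof using phi_gt0 phi_sqr.
move=> ji ki; apply: le_trans (lerD (psiX_le ki) (psiX_le ji)).
suff -> : phi^-1 ^+ i = phi^-1 ^+ i.+2 + phi^-1 ^+ i.+1 by [].
rewrite !exprS !mulrA -mulrDl -[LHS]mul1r; congr (_ * _).
have phi0 : phi != 0 by rewrite gt_eqF.
by field: phi_sqr.
Qed.

(** [delta] is to be thought of as a distance to a target set, its zeros, and
[S] as a two-coloring of the remaining vertices that no edge violates: without
passing through the target, pegs of different colors never meet. *)
Variables (S : pred T) (delta : T -> nat).

Definition side_weight (b : bool) (D : {set T}) : R :=
  \sum_(v in D | S v == b) phi^-1 ^+ delta v.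

Hypotheses (e_sym : symmetric e)
  (delta_lip : forall u v, e u v -> (delta u <= (delta v).+1)%N)
  (S_sep : forall u v, e u v -> (0 < delta u)%N -> (0 < delta v)%N -> S u = S v).

Definition blocked (D : {set T}) : Prop :=
  {in D, forall v, (0 < delta v)%N} /\ forall b, side_weight b D < 1.

(** The two pegs removed, u and v, are adjacent and off the target, hence of one
color. If the new peg w were on the target, u and v would weigh at least
phi^-2 + phi^-1 = 1 together. Otherwise w has their color too and weighs at most
as much as they did. *)
Lemma peg_move_blocked D D' : peg_move e D D' -> blocked D -> blocked D'.
Proof using phi_gt0 phi_sqr e_sym delta_lip S_sep.
case/existsP=> u /existsP[v /existsP[w]].
case/and5P=> uD vD uv wD /andP[euv /andP[ewv /eqP ->]] [D0 Dlt].
have [u0 v0] := (D0 u uD, D0 v vD); have Suv := S_sep euv u0 v0.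
pose F b x := if S x == b then phi^-1 ^+ delta x else 0 : R.
have F0 b x : 0 <= F b x.
  by rewrite /F; case: ifP => // _; rewrite exprn_ge0 // invr_ge0 ltW.
set E := D :\: [set u; v].
have sumD b : side_weight b D = F b u + F b v + \sum_(x in E) F b x.
  rewrite /side_weight big_mkcondr /= (big_setD1 u) //=.
  rewrite (big_setD1 v) /=; last by rewrite !inE eq_sym uv.
  by rewrite addrA /E setDDl.
have sumD' b :
    side_weight b (E :|: [set w]) = F b w + \sum_(x in E) F b x.
  rewrite /side_weight big_mkcondr /= setUC big_setU1 //=.
  by rewrite !inE negb_and negb_or (negbTE wD) orbT.
have dv := delta_lip ewv; have dv' : (delta v <= (delta w).+1)%N.
  by apply: delta_lip; rewrite e_sym.
have du : (delta u <= (delta w).+2)%N.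
  by apply: leq_trans (delta_lip euv) _; rewrite ltnS.
have key := psiX_move dv' du.
have w0 : (0 < delta w)%N.
  rewrite lt0n; apply/eqP => dw; rewrite dw expr0 in key.
  have := Dlt (S v); rewrite sumD /F Suv eqxx.
  have : 0 <= \sum_(x in E) F (S v) x by apply: sumr_ge0.
  by rewrite /F; lra.
split=> [x|b].
  by rewrite !inE => /orP[/andP[_ /D0]|/eqP->].
apply: le_lt_trans (Dlt b); rewrite sumD sumD' lerD2r.
by rewrite /F Suv (S_sep ewv w0 v0); case: eqP => _; [| rewrite addr0].
Qed.

Lemma blocked_reach D : blocked D -> {in reach e D, forall v, (0 < delta v)%N}.
Proof using phi_gt0 phi_sqr e_sym delta_lip S_sep.
move=> bD v; rewrite inE => /existsP[D' /andP[/connectP[p eDp ->]]].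
elim: p D eDp bD => [|D1 p IHp] D /=; first by move=> _ [D0 _] /D0.
case/andP=> /peg_move_blocked DD1 /IHp{}IHp /DD1; exact: IHp.
Qed.

End LowerBound.

Section Levels.

Local Open Scope ring_scope.

Variables (R : realFieldType) (phi : R).
Hypotheses (phi_gt0 : 0 < phi) (phi_sqr : phi ^+ 2 = phi + 1).
Variables (T : finType) (e : rel T).

Definition pegs_at (D : {set T}) (l : T -> nat) (i : nat) : nat :=
  #|[set v in D | l v == i]|.

Lemma inflow_pegs_at D l t :
  inflow phi (pegs_at D l) t
    = \sum_(v in D | (l v < t)%N) phi^-1 ^+ (t - l v).
Proof using.
elim: t => [|t IHt] /=; first by rewrite big_pred0 // => v; rewrite ltn0 andbF.
rewrite [RHS](bigID (fun v => l v == t)) /= addrC mulrDr IHt; congr (_ + _).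
  rewrite mulr_sumr; apply: eq_big => [v|v /andP[_ lv]].
    by rewrite ltnS [(l v <= t)%N]leq_eqVlt; case: ltngtP; rewrite ?andbF ?andbT.
  by rewrite subSn ?exprS // ltnW.
have tE v : (v \in D) && (l v < t.+1)%N && (l v == t) ->
    phi^-1 ^+ (t.+1 - l v) = phi^-1.
  by case/andP=> _ /eqP ->; rewrite subSnn expr1.
rewrite (eq_bigr _ tE) sumr_const mulr_natr; congr (_ *+ _); apply: eq_card => v.
rewrite inE [RHS]unfold_in andbAC.
by case: eqP => [->|]; rewrite ?andbF // ltnS leqnn !andbT.
Qed.

Lemma sum_pegs_at D l n : (forall v, (l v < n)%N) ->
  (\sum_(i < n) pegs_at D l i)%N = #|D|.
Proof.
move=> ln; rewrite -sum1_card.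
rewrite (partition_big (fun v => Ordinal (ln v)) xpredT) //=.
apply: eq_bigr => i _; rewrite /pegs_at -sum1_card; apply: eq_bigl => v.
by rewrite !inE -val_eqE.
Qed.

(** An empty level t separates the vertices below it from those above it, so
[blocked_reach] applies to the distance |l v - t| and the coloring l v < t; the
upper side is turned into a lower one by the reversal of levels
l v |-> n - 1 - l v. *)
Lemma can_peg_levels (D : {set T}) (l : T -> nat) n :
  symmetric e ->
  (forall u v, e u v -> (l u <= (l v).+1)%N) ->
  (forall v, (l v < n)%N) -> (forall i, (i < n)%N -> exists v, l v = i) ->
  can_peg e D -> (n <= #|D|.*2)%N.
Proof using phi_gt0 phi_sqr.
move=> e_sym l_lip l_lt l_onto /eqP reachD.
rewrite -(sum_pegs_at D l_lt).
apply: (covered_count phi_gt0 phi_sqr) => t tn c0.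
set A := inflow _ _ _; set B := inflow _ _ _.
case: (lerP 1 A) => A1; first by left.
case: (lerP 1 B) => B1; first by right.
exfalso.
have noD v : v \in D -> l v != t.
  move=> vD; apply/negP => lv; move/eqP: c0; rewrite cards_eq0 => /eqP/setP/(_ v).
  by rewrite !inE vD lv.
have lip' u v : e u v -> (l v <= (l u).+1)%N.
  by move=> euv; apply: l_lip; rewrite e_sym.
pose delta v := ((l v - t) + (t - l v))%N.
pose S v := (l v < t)%N.
have delta_lip x y : e x y -> (delta x <= (delta y).+1)%N.
  by move=> exy; have := l_lip _ _ exy; have := lip' _ _ exy; rewrite /delta; lia.
have S_sep x y : e x y -> (0 < delta x)%N -> (0 < delta y)%N -> S x = S y.
  move=> exy; have := l_lip _ _ exy; have := lip' _ _ exy; rewrite /delta /S.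
  by move=> ? ? ? ?; apply/idP/idP; lia.
suff blD : blocked phi S delta D.
  have [v lv] := l_onto t tn.
  have vR : v \in reach e D by rewrite reachD inE.
  have := blocked_reach phi_gt0 phi_sqr e_sym delta_lip S_sep blD vR.
  by rewrite /delta lv subnn.
split=> [x /noD|b]; first by rewrite /delta; lia.
case: b.
  suff <- : A = side_weight phi S delta true D by [].
  rewrite /A inflow_pegs_at; apply: eq_big => [x|x /andP[_ lx]].
    by rewrite eqb_id.
  by rewrite /delta; congr (_ ^+ _); lia.
suff <- : B = side_weight phi S delta false D by [].
rewrite /B.
have BE m : (m < n)%N ->
  inflow phi (fun i => pegs_at D l (n.-1 - i)) m
    = inflow phi (pegs_at D (fun v => n.-1 - l v)%N) m.
  elim: m => //= m IHm mn; rewrite IHm; last by exact: ltnW.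
  congr (_ * (_ + _%:R)); apply: eq_card => x; rewrite !inE.
  by have := l_lt x; case: (x \in D) => //= ?; apply/eqP/eqP; lia.
rewrite BE; last by lia.
rewrite inflow_pegs_at; apply: eq_big => [x|x].
  have := l_lt x; case xD: (x \in D) => //= ?.
  by have := noD x xD; rewrite /S eqbF_neg => ?; apply/idP/idP; lia.
case/andP=> /noD ? ?; have := l_lt x => ?; congr (_ ^+ _); rewrite /delta; lia.
Qed.

End Levels.

(** * Distances and the bound by the diameter *)

Section GoldenRatio.
Local Open Scope ring_scope.

Lemma golden_ratio_exists :
  exists2 phi : realalg, 0 < phi & phi ^+ 2 = phi + 1.
Proof.
pose s : realalg := Num.sqrt 5; have s2 : s * s = 5 by rewrite -expr2 sqr_sqrtr.
have s0 : 0 <= s by apply: sqrtr_ge0.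
exists ((1 + s) / 2); first by lra.
by rewrite expr2; nra.
Qed.

End GoldenRatio.

Section Distance.

Variables (T : finType) (e : rel T).
Hypothesis e_conn : connected_graph e.

Lemma dist_step x u v : e u v -> dist e x v <= (dist e x u).+1.
Proof using e_conn.
move=> euv; have [_ conn] := e_conn.
have /existsP[p /andP[ep /eqP lp]] := dist_walk (conn x u).
have := @dist_min _ e x v (rcons p v); rewrite rcons_path ep lp euv last_rcons.
by rewrite size_rcons size_tuple; apply.
Qed.

Lemma lipschitz_path (l : T -> nat) x p :
  (forall u v, e u v -> l v <= (l u).+1) -> path e x p ->
  l (last x p) <= l x + size p.
Proof.
move=> lip; elim: p x => [|z p IHp] x /=; first by rewrite addn0.
by case/andP=> /lip le_z /IHp /leq_trans; apply; rewrite addnS -addSn leq_add2r.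
Qed.

Lemma lipschitz_dist (l : T -> nat) x y :
  (forall u v, e u v -> l v <= (l u).+1) -> l y <= l x + dist e x y.
Proof using e_conn.
move=> lip; have [_ conn] := e_conn.
have /existsP[p /andP[ep /eqP lp]] := dist_walk (conn x y).
by have := lipschitz_path lip ep; rewrite lp size_tuple.
Qed.

Lemma path_attains (l : T -> nat) x p i :
  (forall u v, e u v -> l v <= (l u).+1) -> path e x p ->
  l x <= i <= l (last x p) -> exists v, l v = i.
Proof.
move=> lip; elim: p x => [|y p IHp] x /=.
  by move=> _ /anti_leq <-; exists x.
case/andP=> exy ep /andP[]; rewrite leq_eqVlt => /predU1P[<-|lt_i le_i].
  by exists x.
by apply: (IHp y) => //; rewrite le_i (leq_trans (lip _ _ exy)).
Qed.

Lemma distxx x : dist e x x = 0.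
Proof. by apply/eqP; rewrite -leqn0 (@dist_min _ e x x [::]). Qed.

Lemma diameter_attained : exists x y, diameter e = dist e x y.
Proof using e_conn.
have [T0 _] := e_conn; rewrite /diameter.
have [x ->] := bigop.eq_bigmax (fun x => \max_y dist e x y) T0.
by have [y ->] := bigop.eq_bigmax (dist e x) T0; exists x, y.
Qed.

Lemma dist_le_diameter x y : dist e x y <= diameter e.
Proof.
rewrite /diameter (leq_trans _ (leq_bigmax x)) //.
exact: (leq_bigmax (F := dist e x) y).
Qed.

(** The case of [can_peg_levels] where the levels are the distances from an
endpoint of a diameter; a shortest walk to the other endpoint visits them all. *)
Lemma can_peg_diameter (D : {set T}) :
  symmetric e -> can_peg e D -> diameter e < #|D|.*2.
Proof using e_conn.
move=> e_sym pegD; have [_ conn] := e_conn.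
have [phi phi0 phi2] := golden_ratio_exists.
have [x [y dxy]] := diameter_attained.
apply: (can_peg_levels phi0 phi2 (l := dist e x) e_sym _ _ _ pegD).
- by move=> u v euv; apply: dist_step; rewrite e_sym.
- by move=> v; rewrite ltnS dist_le_diameter.
move=> i; rewrite ltnS dxy => le_i.
have /existsP[p /andP[ep /eqP lp]] := dist_walk (conn x y).
apply: (@path_attains _ x p) => //; first by move=> u v; apply: dist_step.
by rewrite distxx lp.
Qed.

End Distance.

(** * Pegging along a dominating path *)

Section DominatingPath.

Variables (T : finType) (e : rel T).
Hypothesis e_sym : symmetric e.

Lemma mem_reach (D : {set T}) a : a \in D -> a \in reach e D.
Proof. by move=> aD; rewrite inE; apply/existsP; exists D; rewrite connect0. Qed.

Lemma reach_peg_move (D : {set T}) u v w a :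
  u \in D -> v \in D -> u != v -> w \notin D -> e u v -> e w v ->
  a \in reach e ((D :\: [set u; v]) :|: [set w]) -> a \in reach e D.
Proof.
move=> uD vD uv wD euv ewv; rewrite !inE => /existsP[D' /andP[cD' aD']].
apply/existsP; exists D'; rewrite aD' andbT; apply: connect_trans cD'.
apply: connect1; apply/existsP; exists u; apply/existsP; exists v.
by apply/existsP; exists w; rewrite uD vD uv wD euv ewv /=.
Qed.

Lemma reach_neighbor (D : {set T}) u v w :
  u \in D -> v \in D -> u != v -> e u v -> e v w -> w \in reach e D.
Proof using e_sym.
move=> uD vD uv euv evw; case: (boolP (w \in D)) => [/mem_reach //|wD].
rewrite e_sym in evw; apply: (reach_peg_move uD vD uv wD euv evw).
by apply: mem_reach; rewrite !inE eqxx orbT.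
Qed.

Fixpoint odds (s : seq T) : seq T :=
  if s is _ :: y :: s' then y :: odds s' else [::].

Lemma odds_sub s : {subset odds s <= behead s}.
Proof.
move: s; fix IHs 1 => -[|x [|y s]] //= z; rewrite !inE.
by case/orP=> [->//|/IHs /mem_behead ->]; rewrite orbT.
Qed.

Lemma size_odds s : size (odds s) = (size s)./2.
Proof. by move: s; fix IHs 1 => -[|x [|y s]] //=; rewrite IHs. Qed.

(** Induction on the path x, y, z, t, ...: the pegs on x and y reach the
neighbors of x and y, and the move of x over y to z turns the distribution into
the one that belongs to the path z, t, ... *)
Lemma ladder_reach x s a b :
  uniq (x :: s) -> path e x s -> odd (size s) ->
  b \in x :: s -> (a == b) || e b a ->
  a \in reach e (x |: [set z in odds (x :: s)]).
Proof using e_sym.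
have [n] := ubnP (size s); elim: n x s => // n IHn x [|y s] //= le_n.
rewrite inE negb_or => /and3P[/andP[xy xs] ys us] /andP[exy es] /= odd_s.
set D := _ |: _.
have xD : x \in D by rewrite !inE eqxx.
have yD : y \in D by rewrite !inE eqxx orbT.
have eyx : e y x by rewrite e_sym.
have yx : y != x by rewrite eq_sym.
rewrite !in_cons => /or3P[/eqP->|/eqP->|bs] ab.
- by case/predU1P: ab => [->|/(reach_neighbor yD xD yx eyx)//]; apply: mem_reach.
- by case/predU1P: ab => [->|/(reach_neighbor xD yD xy exy)//]; apply: mem_reach.
case: s => [|z s] // in le_n xs ys us es odd_s bs D xD yD *.
have /= /andP[zs us'] := us; have /= /andP[eyz es'] := es.
have sub := @odds_sub (z :: s).
have zD : z \notin D.
  rewrite !inE; apply/or3P; case=> [/eqP zx|/eqP zy|/sub /= zs'].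
  - by rewrite -zx mem_head in xs.
  - by rewrite -zy mem_head in ys.
  - by rewrite zs' in zs.
apply: (reach_peg_move xD yD xy zD exy _); first by rewrite e_sym.
suff -> : D :\: [set x; y] :|: [set z] = z |: [set t in odds (z :: s)].
  by apply: IHn bs ab => //; first [by rewrite -ltnS ltnW | by rewrite /= negbK in odd_s].
rewrite setUC; congr (_ :|: _); apply/setP=> t; rewrite !inE negb_or.
have xo : x \notin odds (z :: s).
  by apply: contra xs => /sub /= xs'; rewrite inE xs' orbT.
have yo : y \notin odds (z :: s).
  by apply: contra ys => /sub /= ys'; rewrite inE ys' orbT.
case: (eqVneq t x) => [->|_] /=; first by rewrite (negbTE xo).
by case: (eqVneq t y) => [->|_] //=; rewrite (negbTE yo).
Qed.

Lemma optimal_pegging_dominating_path w :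
  uniq w -> sorted e w -> 0 < size w -> ~~ odd (size w) ->
  (forall a, exists2 b, b \in w & (a == b) || e b a) ->
  optimal_pegging e <= (size w)./2.+1.
Proof using e_sym.
case: w => // x s uw ew _ odd_s dom.
apply: leq_trans (optimal_pegging_min (D := x |: [set z in odds (x :: s)]) _) _.
  apply/eqP/setP=> a; rewrite [RHS]inE; have [b bw ab] := dom a.
  by apply: ladder_reach bw ab => //; rewrite /= negbK in odd_s.
rewrite cardsU1 -size_odds -add1n leq_add ?leq_b1 //.
by rewrite cardsE card_size.
Qed.

End DominatingPath.

(** * Caterpillars *)

Section Caterpillar.

Variables (T : finType) (e : rel T).
Hypotheses (e_sym : symmetric e) (e_conn : connected_graph e).

Lemma connected_closed (P : pred T) x :
  (forall u v, e u v -> P u -> P v) -> P x -> forall y, P y.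
Proof using e_conn.
move=> closP Px y; have [_ conn] := e_conn.
have /connectP[p ep ->] := conn x y.
by elim: p x ep Px => //= z p IHp x /andP[/closP exz /IHp{}IHp] /exz.
Qed.

Lemma leaf_neighbor_unique x y z : x \in leaves e -> e x y -> e x z -> y = z.
Proof.
rewrite inE => /cards1P[a aE] exy exz.
by have [/set1P-> /set1P->] : y \in [set a] /\ z \in [set a] by rewrite -aE !inE.
Qed.

Lemma leaf_neighbor x : x \in leaves e -> exists y, e x y.
Proof.
rewrite inE => /cards1P[a aE]; exists a.
by have := set11 a; rewrite -aE inE.
Qed.

(** Two adjacent leaves would form a whole connected component, leaving no place
for the vertex c. *)
Lemma leaf_adj_nonleaf x y c :
  c \notin leaves e -> x \in leaves e -> e x y -> y \notin leaves e.
Proof using e_sym e_conn.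
move=> cN xL exy; apply/negP => yL.
have closed u v : e u v -> (u == x) || (u == y) -> (v == x) || (v == y).
  move=> euv /orP[]/eqP ux; rewrite ux in euv.
    by rewrite (leaf_neighbor_unique xL euv exy) eqxx orbT.
  by rewrite e_sym in exy; rewrite (leaf_neighbor_unique yL euv exy) eqxx.
have := connected_closed (P := fun u => (u == x) || (u == y)) closed (x := x).
by rewrite eqxx => /(_ isT c) /orP[]/eqP cE; rewrite cE ?xL ?yL in cN.
Qed.

Variables (n : nat) (f : 'I_n.+1 -> T).
Hypotheses (f_inj : injective f)
  (f_im : [set f i | i : 'I_n.+1] = ~: leaves e)
  (f_adj : forall i j, e (f i) (f j) = (i.+1 == j) || (j.+1 == i)).

Lemma spine_nonleaf i : f i \notin leaves e.
Proof using f_im. by rewrite -in_setC -f_im imset_f. Qed.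

Lemma nonleaf_spine x : x \notin leaves e -> exists i, x = f i.
Proof using f_im. by rewrite -in_setC -f_im => /imsetP[i _ ->]; exists i. Qed.

Lemma column_exists x :
  exists i, x = f i \/ (x \in leaves e /\ e x (f i)).
Proof using e_sym e_conn f_im.
case: (boolP (x \in leaves e)) => [xL|/nonleaf_spine[i ->]]; last first.
  by exists i; left.
have [y exy] := leaf_neighbor xL.
have [i yE] := nonleaf_spine (leaf_adj_nonleaf (spine_nonleaf ord0) xL exy).
by exists i; right; rewrite -yE.
Qed.

Lemma degree_gt0 x y : x != y -> 0 < degree e x.
Proof using e_conn.
apply: contraNltn; rewrite leqn0 cards_eq0 => /eqP/setP N0.
rewrite eq_sym; apply: (@connected_closed (pred1 x) x) => //= u v euv /eqP ux.
by have := N0 v; rewrite !inE -ux euv.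
Qed.

(** A tip of the spine has at most one neighbor on the spine, none if the spine
is a single vertex, but it is not a leaf and so has at least two neighbors. *)
Lemma tip_leaves (i : 'I_n.+1) : (i == ord0) || (i == ord_max) -> 0 < degree e (f i) ->
  (n == 0).+1 <= #|[set y | e (f i) y] :&: leaves e|.
Proof using f_im f_adj.
move=> tip deg0; set N := [set y | _].
have deg1 : 1 < #|N|.
  rewrite ltn_neqAle eq_sym deg0 andbT.
  by have := spine_nonleaf i; rewrite inE.
suff: #|N :\: leaves e| <= (n != 0) by have := cardsID (leaves e) N; case: eqP; lia.
have spineN y : y \in N :\: leaves e ->
    exists2 j, y = f j & (i.+1 == j) || (j.+1 == i).
  rewrite inE [_ \in N]inE => /andP[yL eiy]; have [j yE] := nonleaf_spine yL.
  by exists j => //; rewrite -f_adj -yE.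
case: (eqVneq n 0) => [n0|_].
  rewrite leqn0 cards_eq0; apply/eqP/setP => y; rewrite [RHS]inE.
  by apply/negP => /spineN[j _]; have := ltn_ord i; have := ltn_ord j; lia.
apply/card_le1_eqP => y z /spineN[j -> ij] /spineN[k -> ik]; congr f.
apply: val_inj => /=; have := ltn_ord j; have := ltn_ord k.
by case/orP: tip => /eqP iE; rewrite iE /= in ij ik; lia.
Qed.

Lemma distinct_tip_leaves : 0 < degree e (f ord0) ->
  exists l0 lR, [/\ l0 \in leaves e, lR \in leaves e, l0 != lR,
                    e l0 (f ord0) & e lR (f ord_max)].
Proof using e_sym e_conn f_inj f_im f_adj.
move=> deg0; have := tip_leaves (i := ord0) isT deg0.
case: (eqVneq n 0) => [n0|n0].
  have max0 : ord_max = ord0 :> 'I_n.+1 by apply: val_inj.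
  case/card_gt1P=> l0 [lR] [/setIP[+ L0] /setIP[+ LR] neq].
  by rewrite !inE => e0 eR; exists l0, lR; rewrite max0 !(e_sym _ (f _)).
case/card_gt0P=> l0 /setIP[+ L0]; rewrite inE => e0.
have tips : f ord_max != f ord0 by apply: contraNneq n0 => /f_inj/(congr1 val)/=->.
have := tip_leaves (i := ord_max) _ (degree_gt0 tips).
rewrite eqxx orbT => /(_ isT)/(leq_trans (ltn0Sn _))/card_gt0P[lR].
case/setIP=> + LR; rewrite inE => eR.
exists l0, lR; rewrite !(e_sym _ (f _)); split=> //.
apply: contraNneq tips => l0R; rewrite -l0R e_sym in eR; rewrite e_sym in e0.
by rewrite (leaf_neighbor_unique L0 eR e0).
Qed.

(** A dominating path with an even number of vertices is needed: the spine, or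
the spine preceded by the leaf l0. *)
Lemma optimal_pegging_spine l0 : l0 \in leaves e -> e l0 (f ord0) ->
  optimal_pegging e <= uphalf n.+3.
Proof using e_sym e_conn f_inj f_im f_adj.
move=> l0L el0; pose w := codom f.
have size_w : size w = n.+1 by rewrite size_codom card_ord.
have nth_w i : i < n.+1 -> nth l0 w i = f (inord i).
  move=> lt_i; rewrite (nth_map ord0) ?size_enum_ord //; congr f.
  by apply: val_inj; rewrite /= nth_enum_ord // inordK.
have w_uniq : uniq w by rewrite map_inj_uniq ?enum_uniq.
have w_sorted : sorted e w.
  apply/(sortedP l0) => i; rewrite size_w => lt_i.
  by rewrite !nth_w ?(ltnW lt_i) // f_adj !inordK ?(ltnW lt_i) ?eqxx.
have w_dom a : exists2 b, b \in w & (a == b) || e b a.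
  have [i [aE|[_ eai]]] := column_exists a; exists (f i); rewrite ?codom_f //.
    by rewrite aE eqxx.
  by rewrite e_sym eai orbT.
case: (boolP (odd (size w))) => odd_w; last first.
  have := optimal_pegging_dominating_path e_sym w_uniq w_sorted _ odd_w w_dom.
  rewrite size_w => /(_ isT) /leq_trans; apply.
  exact: (half_leq (leqnSn n.+1)).
apply: (@leq_trans (size (l0 :: w))./2.+1); last by rewrite /= size_w.
apply: optimal_pegging_dominating_path => //.
- rewrite cons_uniq w_uniq andbT; apply/negP => /codomP[i l0E].
  by rewrite l0E (negbTE (spine_nonleaf i)) in l0L.
- case wE: w size_w => [|x s] // _; rewrite /= -[path _ _ _]/(sorted e (x :: s)) -wE.
  rewrite w_sorted andbT (_ : x = f ord0) //.
  by rewrite -[x]/(nth l0 (x :: s) 0) -wE nth_w //; congr f; apply: val_inj; rewrite /= inordK.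
- by rewrite /= odd_w.
by move=> a; have [b bw ab] := w_dom a; exists b => //; rewrite inE bw orbT.
Qed.

(** Number the spine by 1, ..., n + 1 and give each leaf the number before that of
its neighbor, except lR, which gets n + 2. Adjacent vertices get consecutive
numbers, so l0 (number 0) and lR are at distance at least n + 2. *)
Lemma diameter_ge_spine l0 lR :
  l0 \in leaves e -> lR \in leaves e -> l0 != lR ->
  e l0 (f ord0) -> e lR (f ord_max) -> n.+2 <= diameter e.
Proof using e_sym e_conn f_inj f_im f_adj.
move=> l0L lRL l0R el0 elR.
have [col colP] := fin_all_exists column_exists.
have col_leaf x : x \in leaves e -> e x (f (col x)).
  by case: (colP x) => [xE|[]//] xL; rewrite xE (negbTE (spine_nonleaf _)) in xL.
have col_spine i : col (f i) = i.
  case: (colP (f i)) => [/f_inj<-//|[]].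
  by rewrite (negbTE (spine_nonleaf _)).
have leaf_col x i : x \in leaves e -> e x (f i) -> col x = i.
  move=> xL exi; apply: f_inj.
  exact: leaf_neighbor_unique xL (col_leaf x xL) exi.
pose lev x :=
  if x == lR then n.+2 else if x \in leaves e then col x : nat else (col x).+1.
have lev_spine i : lev (f i) = i.+1.
  rewrite /lev (negbTE (spine_nonleaf i)) col_spine.
  by case: eqP (spine_nonleaf i) => // ->; rewrite lRL.
have lev_leaf x i : x \in leaves e -> e x (f i) ->
    lev x <= i.+2 /\ i.+1 <= (lev x).+1.
  move=> xL exi; rewrite /lev xL (leaf_col x i) //; case: eqP => [xR|_].
    have := leaf_col x i xL exi; rewrite xR (leaf_col lR ord_max) // => <- /=.
    by split; lia.
  by split; lia.
have lip u v : e u v -> lev v <= (lev u).+1.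
  move=> euv; have [i [uE|[uL eui]]] := column_exists u.
    rewrite {}uE lev_spine in euv *; rewrite e_sym in euv.
    have [j [vE|[vL _]]] := column_exists v; last by case: (lev_leaf v i).
    rewrite {}vE f_adj lev_spine in euv *; lia.
  have [j vE] := nonleaf_spine (leaf_adj_nonleaf (spine_nonleaf i) uL euv).
  by rewrite {}vE lev_spine in euv *; case: (lev_leaf u j).
have := lipschitz_dist e_conn l0 lR lip.
rewrite {1 2}/lev eqxx (negbTE l0R) l0L (leaf_col l0 ord0) //= add0n => le_d.
exact: leq_trans le_d (dist_le_diameter e l0 lR).
Qed.

End Caterpillar.

Lemma optimal_pegging_singleton (T : finType) (e : rel T) (x : T) :
  (forall y, y = x) -> optimal_pegging e <= 1.
Proof.
move=> all_x; rewrite -(cards1 x); apply: optimal_pegging_min.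
by apply/eqP/setP => y; rewrite (all_x y) [RHS]inE mem_reach ?set11.
Qed.

Theorem theorem6p1 (T : finType) (e : rel T)
  (e_sym : symmetric e) (e_irr : irreflexive e)
  (E_caterpillar : is_caterpillar e) :
  optimal_pegging e = uphalf (diameter e).+1.
Proof.
have [[e_conn _] [n [f [f_inj f_im f_adj]]]] := E_caterpillar.
apply/eqP; rewrite eqn_leq; apply/andP; split; last first.
  have [D pegD <-] := optimal_pegging_attained e.
  by rewrite leq_uphalf_double; exact: can_peg_diameter.
case: (posnP (degree e (f ord0))) => [deg0|deg_gt0].
  apply: leq_trans (optimal_pegging_singleton e (x := f ord0) _) _ => // y.
  apply/eqP; rewrite eq_sym; apply: contraTT isT => /(degree_gt0 e_conn).
  by rewrite deg0.
have [l0 [lR [L0 LR neq e0 eR]]] :=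
  distinct_tip_leaves e_sym e_conn f_inj f_im f_adj deg_gt0.
apply: leq_trans (optimal_pegging_spine e_sym e_conn f_inj f_im f_adj L0 e0) _.
rewrite uphalf_leq // ltnS.
exact (diameter_ge_spine e_sym e_conn f_inj f_im f_adj L0 LR neq e0 eR).
Qed.
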